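(* Let $n\geq 0$ be an integer and let $X$ be a metric space with asymptotic dimension at most $n$. Then there exist trees $T^0,\ldots,T^n$ and a coarse embedding $X\to\prod_{j=0}^n T^j$ of $X$ into the product of these $n+1$ trees. If moreover $X$ is proper, the trees $T^0,\ldots,T^n$ can be chosen to be locally finite.
   Context: A metric space $X$ is proper if every bounded, closed subspace is compact. A metric space $X$ has asymptotic dimension at most $n$ if for every $r>0$ there exist $f(r)\in\mathbb{R}$ and families $\mathcal{U}^0,\ldots,\mathcal{U}^n$ of subspaces of $X$ such that: (1) $X=\bigcup_{i=0}^n\bigcup_{U\in\mathcal{U}^i}U$; (2) for every $i$ each $U\in\mathcal{U}^i$ has diameter at most $f(r)$; (3) each $\mathcal{U}^i$ is $r$-disjoint, that is, $d(V,U)\geq r$ for all $V,U\in\mathcal{U}^i$ with $U\neq V$. Here $d(U,V)=\inf\{d(u,v)\mid u\in U,v\in V\}$. A tree is a connected graph without cycles, regarded as a metric space with the path metric in which every edge has length $1$. It is locally finite if every vertex is incident to only finitely many edges. The product $\prod_{j=0}^nT^j$ carries the metric $d((t_j)_j,(t'_j)_j)=\sup_{0\leq j\leq n}d_{T^j}(t_j,t'_j)$. A function $F\colon X\to Y$ between metric spaces is uniformly expansive if there is a non-decreasing function $\rho\colon[0,\infty)\to[0,\infty)$ with $d_Y(F(x),F(y))\leq\rho(d_X(x,y))$ for all $x,y\in X$. It is effectively proper if there is a proper non-decreasing function $\delta\colon[0,\infty)\to[0,\infty)$ with $\delta(d_X(x,y))\leq d_Y(F(x),F(y))$ for all $x,y\in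 X$ (proper for a non-decreasing function means $\delta(t)\to\infty$ as $t\to\infty$). It is a coarse embedding if it is both uniformly expansive and effectively proper. *)

(* Defs.v *)
From HB Require Import structures.
From mathcomp Require Import all_boot all_order all_algebra.
From mathcomp Require Import all_classical all_reals all_analysis.
From mathcomp Require Import lra.

Set Implicit Arguments.
Unset Strict Implicit.
Unset Printing Implicit Defensive.

Import Order.TTheory GRing.Theory Num.Theory.

Local Open Scope classical_set_scope.
Local Open Scope ring_scope.

Section MetricNotions.
Context {R : realType}.
Implicit Types X Y : metricType R.

(* In these extended-real suprema and infima, the diameter of the empty set is
   -oo and the distance from the empty set to any set is +oo. *)
Definition diam X (A : set X) : \bar R :=
  ereal_sup [set (mdist p.1 p.2)%:E | p in A `*` A].

Definition set_dist X (A B : set X) : \bar R :=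
  ereal_inf [set (mdist p.1 p.2)%:E | p in A `*` B].

Definition proper_space X : Prop :=
  forall A : set X, (diam A < +oo)%E -> closed A -> compact A.

Definition asdim_le X (n : nat) : Prop :=
  forall r : R, 0 < r ->
    exists (f : R) (U : 'I_n.+1 -> set (set X)),
      [/\ \bigcup_i \bigcup_(A in U i) A = setT,
          forall i A, U i A -> (diam A <= f%:E)%E &
          forall i A B, U i A -> U i B -> A <> B -> (r%:E <= set_dist A B)%E].

(* Non-decreasing functions [0, +oo[ -> [0, +oo[ are represented by functions
   R -> R, of which only the restriction to [0, +oo[ is used. *)
Definition control_function (rho : R -> R) : Prop :=
  (forall t, 0 <= t -> 0 <= rho t) /\
  (forall s t, 0 <= s -> s <= t -> rho s <= rho t).

Definition uniformly_expansive X Y (F : X -> Y) : Prop :=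
  exists2 rho : R -> R, control_function rho &
    forall x y, mdist (F x) (F y) <= rho (mdist x y).

Definition effectively_proper X Y (F : X -> Y) : Prop :=
  exists delta : R -> R,
    [/\ control_function delta,
        delta t @[t --> +oo] --> +oo &
        forall x y, delta (mdist x y) <= mdist (F x) (F y)].

Definition coarse_embedding X Y (F : X -> Y) : Prop :=
  uniformly_expansive F /\ effectively_proper F.

End MetricNotions.

(* The graph is simple, so the cycles to exclude have at least three vertices;
   a list [:: u; v] with u, v adjacent is a [cycle] of size 2. *)
Record tree := Tree {
  vertex : choiceType;
  adj : rel vertex;
  adj_sym : symmetric adj;
  adj_irr : irreflexive adj;
  tree_nonempty : inhabited vertex;
  tree_connected : forall u v, exists2 p, path adj u p & last u p = v;
  tree_acyclic : forall c, ucycle adj c -> (size c <= 2)%N }.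

Definition locally_finite_tree (T : tree) : Prop :=
  forall u : vertex T, finite_set [set v | adj u v].

(* The geometric realization of a tree, edge interiors included: a point is
   given by its barycentric coordinates, a function on the vertices, and
   [edge_point u v t] is the point at distance t from u on the edge uv.
   The case u = v of [tree_point] yields the vertices, also when there is no
   edge. *)
Section Realization.
Context (R : realType) (T : tree).
Implicit Types (u v w : vertex T) (x y z : vertex T -> R) (s t l : R).

Definition edge_point u v t : vertex T -> R :=
  fun w => (1 - t) * (w == u)%:R + t * (w == v)%:R.

Definition tree_point x : Prop :=
  exists u v t, [/\ u = v \/ adj u v, 0 <= t <= 1 & x = edge_point u v t].

Record tree_space := TreeSpace {
  coord :> vertex T -> R;
  coordP : `[< tree_point coord >] }.

HB.instance Definition _ := [isSub for coord].
HB.instance Definition _ := [Choice of tree_space by <:].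

(* [polyline x y l]: some path from x to y of length l is a concatenation of
   segments, each contained in a closed edge. The path metric is the infimum
   of such lengths. *)
Inductive polyline : (vertex T -> R) -> (vertex T -> R) -> R -> Prop :=
| polyline_nil x : polyline x x 0
| polyline_cons u v s t y l :
    adj u v -> 0 <= s <= 1 -> 0 <= t <= 1 ->
    polyline (edge_point u v t) y l ->
    polyline (edge_point u v s) y (`|s - t| + l).

Definition tree_dist (x y : tree_space) : R := inf [set l | polyline x y l].

Lemma polyline_ge0 x y l : polyline x y l -> 0 <= l.
Proof. by elim=> // *; rewrite addr_ge0. Qed.

Lemma polyline_trans x y z l l' :
  polyline x y l -> polyline y z l' -> polyline x z (l + l').
Proof.
elim=> [{}x|u v s t {}y {}l uv s01 t01 _ IH yz]; first by rewrite add0r.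
by rewrite -addrA; apply: polyline_cons => //; exact: IH.
Qed.

Lemma polyline_seg u v s t : adj u v -> 0 <= s <= 1 -> 0 <= t <= 1 ->
  polyline (edge_point u v s) (edge_point u v t) `|s - t|.
Proof.
move=> uv s01 t01; rewrite -[`|_|]addr0.
by apply: polyline_cons => //; exact: polyline_nil.
Qed.

Lemma polyline_sym x y l : polyline x y l -> polyline y x l.
Proof.
elim=> [{}x|u v s t {}y {}l uv s01 t01 _ IH]; first exact: polyline_nil.
by rewrite addrC distrC; apply: polyline_trans IH _; exact: polyline_seg.
Qed.

Lemma polyline_coord x y l w : polyline x y l -> `|x w - y w| <= l.
Proof.
elim=> [{}x|u v s t {}y {}l _ _ _ _ IH]; first by rewrite subrr normr0.
apply: le_trans (ler_distD (edge_point u v t w) _ _) _; apply: lerD => //.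
rewrite /edge_point.
have -> : (1 - s) * (w == u)%:R + s * (w == v)%:R -
          ((1 - t) * (w == u)%:R + t * (w == v)%:R)
          = (s - t) * ((w == v)%:R - (w == u)%:R) :> R by lra.
rewrite normrM ler_piMr//.
by case: (w == v); case: (w == u);
  rewrite ?subrr ?subr0 ?sub0r ?normrN ?normr1 ?normr0.
Qed.

Lemma edge_point0 u v : edge_point u v 0 = edge_point u u 0.
Proof. by apply/funext => w; rewrite /edge_point !mul0r. Qed.

Lemma edge_point1 u v : edge_point u v 1 = edge_point v v 0.
Proof. by apply/funext => w; rewrite /edge_point subrr subr0 !mul0r add0r addr0. Qed.

Lemma polyline_vertex u v : exists l, polyline (edge_point u u 0) (edge_point v v 0) l.
Proof.
have [p pp <-] := tree_connected u v; elim: p u pp => [|w p IH] u /=.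
  by exists 0; exact: polyline_nil.
move=> /andP[uw /IH[l wl]]; exists (`|0 - 1| + l).
rewrite -(edge_point0 u w); apply: polyline_cons; rewrite ?lexx ?ler01//.
by rewrite edge_point1.
Qed.

Lemma polyline_to_vertex x : tree_point x -> exists u l, polyline x (edge_point u u 0) l.
Proof.
move=> [u [v [t [uv t01 ->]]]]; exists u; case: uv => [<-|uv].
  exists 0; suff -> : edge_point u u t = edge_point u u 0 by exact: polyline_nil.
  by apply/funext => w; rewrite /edge_point; lra.
exists `|t - 0|; rewrite -(edge_point0 u v).
by apply: polyline_seg; rewrite // lexx ler01.
Qed.

Lemma polyline_ex (x y : tree_space) : [set l | polyline x y l] !=set0.
Proof.
have /asboolP/polyline_to_vertex[u [l1 h1]] := coordP x.
have /asboolP/polyline_to_vertex[v [l2 h2]] := coordP y.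
have [l h] := polyline_vertex u v.
exists (l1 + l + l2).
exact: polyline_trans (polyline_trans h1 h) (polyline_sym h2).
Qed.

Lemma polyline_lb x y : has_lbound [set l | polyline x y l].
Proof. by exists 0 => l /polyline_ge0. Qed.

Lemma tree_dist_le (x y : tree_space) l : polyline x y l -> tree_dist x y <= l.
Proof. exact/ge_inf/polyline_lb. Qed.

Lemma le_tree_dist (x y : tree_space) c :
  (forall l, polyline x y l -> c <= l) -> c <= tree_dist x y.
Proof. by move=> h; apply: lb_le_inf => //; exact: polyline_ex. Qed.

Lemma tree_distxx (x : tree_space) : tree_dist x x = 0.
Proof.
apply/eqP; rewrite eq_le tree_dist_le//=; last exact: polyline_nil.
by apply: le_tree_dist => l /polyline_ge0.
Qed.

Lemma tree_dist_eq0 (x y : tree_space) : tree_dist x y = 0 -> x = y.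
Proof.
move=> xy0; apply/val_inj/funext => w /=; apply/eqP.
rewrite -subr_eq0 -normr_le0 -xy0.
by apply: le_tree_dist => l; exact: polyline_coord.
Qed.

Lemma tree_dist_sym (x y : tree_space) : tree_dist x y = tree_dist y x.
Proof.
by apply/eqP; rewrite eq_le; apply/andP; split; apply: le_tree_dist => l h;
  exact/tree_dist_le/polyline_sym.
Qed.

Lemma tree_dist_triangle (y x z : tree_space) : tree_dist x z <= tree_dist x y + tree_dist y z.
Proof.
rewrite -lerBlDr; apply: le_tree_dist => l h.
rewrite lerBlDr -lerBlDl; apply: le_tree_dist => l' h'.
by rewrite lerBlDl; apply: tree_dist_le; exact: polyline_trans h h'.
Qed.

HB.instance Definition _ := @isMetric.Build R tree_space
  tree_dist tree_distxx tree_dist_eq0 tree_dist_sym tree_dist_triangle.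

End Realization.

Section SupProduct.
Context (R : realType) (n : nat) (Y : 'I_n.+1 -> metricType R).

Definition sup_product : Type := forall j, Y j.

HB.instance Definition _ := gen_eqMixin sup_product.
HB.instance Definition _ := gen_choiceMixin sup_product.

(* Distances are nonnegative, so starting from 0 does not change the maximum. *)
Definition sup_dist (a b : sup_product) : R :=
  \big[Num.max/0]_(j < n.+1) mdist (a j) (b j).

Lemma le_sup_dist j (a b : sup_product) : mdist (a j) (b j) <= sup_dist a b.
Proof. exact: le_bigmax. Qed.

Lemma sup_distxx a : sup_dist a a = 0.
Proof.
apply: (big_ind (fun x => x = 0)) => // [x y -> ->|j _]; first by rewrite maxxx.
exact: mdistxx.
Qed.

Lemma sup_dist_eq0 a b : sup_dist a b = 0 -> a = b.
Proof.
move=> ab0; apply: (@functional_extensionality_dep _ _ a b) => j.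
apply: mdist_positivity; apply/eqP; rewrite eq_le mdist_ge0 andbT -ab0.
exact: le_sup_dist.
Qed.

Lemma sup_dist_sym a b : sup_dist a b = sup_dist b a.
Proof. by apply: eq_bigr => j _; exact: metric_sym. Qed.

Lemma sup_dist_triangle b a c : sup_dist a c <= sup_dist a b + sup_dist b c.
Proof.
apply: bigmax_le => [|j _].
  by apply: addr_ge0; apply: le_trans (le_sup_dist ord0 _ _); exact: mdist_ge0.
by rewrite (le_trans (metric_triangle _ (b j) _))// lerD// le_sup_dist.
Qed.

HB.instance Definition _ := @isMetric.Build R sup_product
  sup_dist sup_distxx sup_dist_eq0 sup_dist_sym sup_dist_triangle.

End SupProduct.

Definition tree_product (R : realType) (n : nat) (T : 'I_n.+1 -> tree) :
  metricType R := sup_product (fun j => tree_space R (T j) : metricType R).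

(* Main.v *)
From HB Require Import structures.
Require Import Defs.
From mathcomp Require Import all_boot all_order all_algebra.
From mathcomp Require Import all_classical all_reals all_analysis.
From mathcomp Require Import lra zify.

(* Fix a base point x0. From the covers given by asdim X <= n at rapidly growing
   scales one builds, for each of the n+1 colours, disjoint bounded families of
   levels k = 0, 1, 2, ... that are nested: a set of level k meeting a set of
   level l > k lies in it together with its k-neighbourhood. To obtain them, a
   set of a new level is saturated by the earlier sets that it meets, each of
   them fattened to a "blob", the blobs being kept nested or disjoint. Merging
   the ball B(x0, k) into a single set of level k makes any two points lie in a
   common set of each colour, so the sets of one colour, each joined to the next
   larger one, form a tree; if X is proper, only finitely many sets of a given
   level meet a bounded set and the tree is locally finite.
   A point is mapped to the smallest set of each colour containing it. If
   d(x, y) <= K then by the k-neighbourhood condition at most K + 1 sets of a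
   colour contain x and not y, which bounds the tree distance. If d(x, y) exceeds
   the diameters of all sets of levels < K, then all the sets of these levels
   containing x separate it from y, and there are at least K of them since the
   n + 1 colours together cover X at every level. *)

Set Implicit Arguments.
Unset Strict Implicit.
Unset Printing Implicit Defensive.

Import Order.TTheory GRing.Theory Num.Theory.

Local Open Scope classical_set_scope.
Local Open Scope ring_scope.

(** * Nested families *)

Section BoundedFamilies.
Context {R : realType} {X : metricType R}.
Implicit Types (E S M : X -> X -> Prop) (r s D : R) (x y z : X).

(* A disjoint family of subsets of X is encoded as the partial equivalence
   relation "x and y lie in a common member". *)
Definition per E : Prop :=
  (forall x y, E x y -> E y x) /\ (forall y x z, E x y -> E y z -> E x z).

Definition bounded_rel D E : Prop := forall x y, E x y -> mdist x y <= D.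

Definition separated_rel r E : Prop :=
  forall x y, E x x -> E y y -> mdist x y < r -> E x y.

Definition equiv_rel E : Prop := per E /\ forall x, E x x.

Definition thicken S E x y : Prop := exists a b, [/\ S x a, E a b & S b y].

Lemma per_refl E x y : per E -> E x y -> E x x.
Proof. by move=> [Es Et] xy; apply: Et xy (Es _ _ xy). Qed.

Lemma sub_thicken S E x y : (forall x, S x x) -> E x y -> thicken S E x y.
Proof. by move=> Srefl xy; exists x, y. Qed.

Section Thicken.
Variables (S E : X -> X -> Prop) (s r D : R).
Hypotheses (Ssym : forall x y, S x y -> S y x) (Sbnd : bounded_rel s S).
Hypotheses (Eper : per E) (Esep : separated_rel r E).

Lemma thicken_per : 2 * s < r -> per (thicken S E).
Proof.
move=> sr; have [Es Et] := Eper; split.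
  move=> x y [a [b [xa ab yb]]]; exists b, a.
  by split; [exact: Ssym|exact: Es|exact: Ssym].
move=> y x z [a [b [xa ab yb]]] [a' [b' [ya' ab' bz']]].
exists a, b'; split => //; apply: (Et b) => //; apply: (Et a') => //.
apply: Esep; [exact: per_refl (Es _ _ ab)|exact: per_refl ab'|].
have := Sbnd yb; have := Sbnd ya'; have := metric_triangle b y a'; lra.
Qed.

Lemma thicken_separated : separated_rel (r - 2 * s) (thicken S E).
Proof.
have [Es Et] := Eper.
move=> x y [a [b [xa ab _]]] [a' [b' [ya' ab' _]]] xy.
exists a, a'; split => //; last exact: Ssym.
apply: Esep; [exact: per_refl ab|exact: per_refl ab'|].
have := Sbnd xa; have := Sbnd ya'; have := metric_triangle a x a'.
have := metric_triangle x y a'; rewrite (metric_sym a x); lra.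
Qed.

Lemma thicken_bounded : bounded_rel D E -> bounded_rel (D + 2 * s) (thicken S E).
Proof.
move=> Eb x y [a [b [/Sbnd xa /Eb ab /Sbnd yb]]].
have := metric_triangle x a y; have := metric_triangle a b y; lra.
Qed.

End Thicken.

Section MergeBall.
Variables (E : X -> X -> Prop) (r D : R) (x0 : X) (l : R).
Hypotheses (Eper : per E) (Esep : separated_rel r E) (Ebnd : bounded_rel D E).
Hypotheses (r_gt0 : 0 < r) (l_ge0 : 0 <= l) (D_ge0 : 0 <= D).

Let near_ball x : Prop :=
  mdist x0 x <= l \/ exists2 z, E x z & mdist x0 z <= l + r.

Definition merge_ball x y : Prop := near_ball x /\ near_ball y \/ E x y.

Let near_ball_E x y : near_ball x -> E x y -> near_ball y.
Proof.
have [Es Et] := Eper.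
case=> [xl xy|[z xz zl] xy]; right.
  by exists x; [exact: Es|have := r_gt0; lra].
by exists z => //; apply: Et xz; exact: Es.
Qed.

Let near_ball_close x y : near_ball x -> E y y -> mdist x y < r -> near_ball y.
Proof.
case=> [xl yy xy|[z xz zl] yy xy].
  by right; exists y => //; have := metric_triangle x0 x y; lra.
apply: (@near_ball_E x); first by right; exists z.
by apply: Esep => //; exact: per_refl xz.
Qed.

Lemma merge_ball_per : per merge_ball.
Proof.
have [Es Et] := Eper; split.
  by move=> x y [[]|/Es]; [left|right].
move=> y x z [[nx ny]|xy] [[ny' nz]|yz].
- by left.
- by left; split => //; exact: near_ball_E yz.
- by left; split => //; exact: near_ball_E (Es _ _ xy).
- by right; exact: Et xy yz.
Qed.

Lemma merge_ball_separated : separated_rel r merge_ball.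
Proof.
move=> x y [[nx _]|xx] [[ny _]|yy] xy.
- by left.
- by left; split => //; exact: near_ball_close xy.
- by left; split => //; apply: near_ball_close ny xx _; rewrite metric_sym.
- by right; exact: Esep.
Qed.

Lemma merge_ball_bounded : bounded_rel (2 * (l + r + D)) merge_ball.
Proof.
have near_bnd x : near_ball x -> mdist x0 x <= l + r + D.
  case=> [|[z /Ebnd xz zl]]; first by have := r_gt0; have := D_ge0; lra.
  by have := metric_triangle x0 z x; rewrite (metric_sym z x); lra.
move=> x y [[/near_bnd nx /near_bnd ny]|/Ebnd]; last first.
  by have := r_gt0; have := l_ge0; have := D_ge0; lra.
by have := metric_triangle x x0 y; rewrite (metric_sym x x0); lra.
Qed.

Lemma merge_ball_sub x y : E x y -> merge_ball x y.
Proof. by right. Qed.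

Lemma merge_ball_ball x y : mdist x0 x <= l -> mdist x0 y <= l -> merge_ball x y.
Proof. by left; split; left. Qed.

End MergeBall.

Lemma asdim_le_per n r : asdim_le X n -> 0 < r ->
  exists (D : R) (E : 'I_n.+1 -> X -> X -> Prop), 0 <= D /\
    (forall i, [/\ per (E i), bounded_rel D (E i) & separated_rel r (E i)]) /\
    forall x, exists i, E i x x.
Proof.
move=> Xn r0; have [f [U [Ucov Ubnd Usep]]] := Xn r r0.
have Uclose i A B x y : U i A -> U i B -> A x -> B y -> mdist x y < r -> A = B.
  move=> UA UB Ax By; apply: contraPP => AB; apply/negP; rewrite -leNgt -lee_fin.
  apply: le_trans (Usep i A B UA UB AB) _.
  by apply: ereal_inf_lbound; exists (x, y).
exists (Num.max 0 f), (fun i x y => exists A, [/\ U i A, A x & A y]).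
split; first by rewrite le_max lexx.
split=> [i|x]; last first.
  have : setT x by [].
  by rewrite -Ucov => -[i _ [A UA Ax]]; exists i, A.
split; first split.
- by move=> x y [A []]; exists A.
- move=> y x z [A [UA Ax Ay]] [B [UB By Bz]].
  have AB : A = B by apply: (Uclose i A B y y) => //; rewrite mdistxx.
  by exists A; split => //; rewrite AB.
- move=> x y [A [UA Ax Ay]]; rewrite le_max -[_ <= f]lee_fin.
  apply/orP; right; apply: le_trans (Ubnd i A UA).
  by apply: ereal_sup_ubound; exists (x, y).
- move=> x y [A [UA Ax _]] [B [UB By _]] xy; exists A; split => //.
  by rewrite (Uclose i A B x y).
Qed.

(* [M] relates the points in a common maximal blob of the previous levels.
   The sets [A] of the new level are [M]-saturated; the new blobs, given by
   [M'], contain their l-neighbourhoods. *)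
Definition next_level n (l : nat) (x0 : X) (M A M' : 'I_n.+1 -> X -> X -> Prop) : Prop :=
  [/\ forall i, [/\ per (A i), separated_rel 1 (A i) &
        forall x y, mdist x0 x <= l%:R -> mdist x0 y <= l%:R -> A i x y],
      forall i, [/\ forall x y, M i x y -> M' i x y,
        forall x y z, M i x y -> A i y z -> A i x z &
        forall x y z, mdist x y <= l%:R -> A i y z -> M' i x z] &
      forall x, exists i, A i x x].

Lemma next_levelP n l x0 (M : 'I_n.+1 -> X -> X -> Prop) D : asdim_le X n ->
  (forall i, equiv_rel (M i) /\ bounded_rel D (M i)) ->
  exists (A M' : 'I_n.+1 -> X -> X -> Prop) D', next_level l x0 M A M' /\
    forall i, equiv_rel (M' i) /\ bounded_rel D' (M' i).
Proof.
move=> Xn HM.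
have D0 : 0 <= D.
  by have [[_ Mr] Mb] := HM ord0; have := Mb _ _ (Mr x0); rewrite mdistxx.
have l0 : 0 <= l%:R :> R by rewrite ler0n.
pose L : R := l%:R; pose r := 4 * D + 2 * L + 1.
have r0 : 0 < r by rewrite /r /L; lra.
have [C [E [C0 [HE Ecov]]]] := asdim_le_per Xn r0.
pose A i := thicken (M i) (merge_ball (E i) r x0 L).
pose close x y := mdist x y <= L.
pose B i := thicken (M i) (thicken close (A i)).
pose M' i x y := M i x y \/ B i x y.
have closes x y : close x y -> close y x by rewrite /close metric_sym.
have closeb : bounded_rel L close by [].
have closer x : close x x by rewrite /close mdistxx.
have HA i : [/\ per (A i), bounded_rel (2 * (L + r + C) + 2 * D) (A i)
                & separated_rel (r - 2 * D) (A i)].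
  have [Ep Eb Es] := HE i; have [[[Ms Mt] Mr] Mb] := HM i.
  have Fp := merge_ball_per x0 L Ep r0.
  have Fs := @merge_ball_separated _ _ x0 L Ep Es r0.
  have Fb := @merge_ball_bounded _ _ _ x0 L Eb r0 l0 C0.
  split; [|exact: thicken_bounded|exact: thicken_separated].
  by apply: (thicken_per Ms Mb Fp Fs); rewrite /r /L; lra.
have HB i : per (B i) /\ bounded_rel (2 * (L + r + C) + 4 * D + 2 * L) (B i).
  have [Ap Ab As] := HA i; have [[[Ms Mt] Mr] Mb] := HM i.
  have Gp : per (thicken close (A i)).
    by apply: (thicken_per closes closeb Ap As); rewrite /r /L; lra.
  have Gs := thicken_separated closes closeb Ap As.
  have Gb := thicken_bounded closeb Ab.
  split; first by apply: (thicken_per Ms Mb Gp Gs); rewrite /r /L; lra.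
  by move=> x y /(thicken_bounded Mb Gb) H; apply: le_trans H _; rewrite /L; lra.
have MB i x y z : M i x y -> B i y z -> B i x z.
  have [[[Ms Mt] Mr] Mb] := HM i.
  by move=> xy [a [b [ya ab bz]]]; exists a, b; split => //; exact: Mt xy ya.
exists A, M', (2 * (L + r + C) + 4 * D + 2 * L); split; first split.
- move=> i; have [Ap Ab As] := HA i; have [[_ Mr] _] := HM i; split => //.
    move=> x y xx yy xy; apply: As => //; apply: lt_le_trans xy _; rewrite /r /L; lra.
  by move=> x y xl yl; apply: sub_thicken => //; exact: merge_ball_ball.
- move=> i; have [[[Ms Mt] Mr] Mb] := HM i; split.
  + by left.
  + by move=> x y z xy [a [b [ya ab bz]]]; exists a, b; split => //; exact: Mt xy ya.
  + move=> x y z xy yz; right; apply: sub_thicken => //.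
    by exists y, z; split.
- move=> x; have [i xi] := Ecov x; exists i; have [[_ Mr] _] := HM i.
  by apply: sub_thicken => //; exact: merge_ball_sub.
- move=> i; have [[[Ms Mt] Mr] Mb] := HM i; have [[Bs Bt] Bb] := HB i.
  split; first split; first split.
  + by move=> x y [/Ms|/Bs]; [left|right].
  + move=> y x z [xy|xy] [yz|yz].
    * by left; exact: Mt yz.
    * by right; exact: MB yz.
    * by right; apply: (Bs); apply: MB (Bs _ _ xy); exact: Ms.
    * by right; exact: Bt yz.
  + by left.
  + move=> x y [/Mb xy|/Bb//]; apply: le_trans xy _; rewrite /r /L; lra.
Qed.

(* The sets of colour i at level k are the classes of [A i k]. *)
Definition hierarchy n (x0 : X) (A : 'I_n.+1 -> nat -> X -> X -> Prop)
    (D : nat -> R) : Prop :=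
  [/\ forall i k, [/\ per (A i k), separated_rel 1 (A i k) &
        forall x y, mdist x0 x <= k%:R -> mdist x0 y <= k%:R -> A i k x y],
      forall i k l x y z, (k < l)%N ->
        A i k y y -> mdist x y <= k%:R -> A i l y z -> A i l x z,
      forall i k l x y z, (k < l)%N -> A i k x y -> A i l y z -> A i l x z,
      forall i k K x y, (k < K)%N -> A i k x y -> mdist x y <= D K &
      forall k x, exists i, A i k x x].

Lemma hierarchy_ex n x0 : asdim_le X n ->
  exists (A : 'I_n.+1 -> nat -> X -> X -> Prop) (D : nat -> R), hierarchy x0 A D.
Proof.
move=> Xn.
pose state := {MD : ('I_n.+1 -> X -> X -> Prop) * R |
  forall i, equiv_rel (MD.1 i) /\ bounded_rel MD.2 (MD.1 i)}.
have stepP (l : nat) (s : state) : exists As' : ('I_n.+1 -> X -> X -> Prop) * state,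
    next_level l x0 (sval s).1 As'.1 (sval As'.2).1.
  have [A [M' [D' [HA HM]]]] := next_levelP l x0 Xn (svalP s).
  by exists (A, exist _ (M', D') HM).
pose step l (s : state) := sval (cid (stepP l s)).
have s0P : forall i : 'I_n.+1, equiv_rel (@eq X) /\ bounded_rel 0 (@eq X).
  move=> i; split; first split; first split => [x y ->|y x z -> ->] //.
  - by [].
  - by move=> x y ->; rewrite mdistxx.
pose s0 : state := exist _ (fun=> @eq X, 0) s0P.
pose s := fix s l : state := if l is l'.+1 then (step l' (s l')).2 else s0.
pose A i l := (step l (s l)).1 i.
pose M i l := (sval (s l)).1 i.
have HA l : next_level l x0 (M ^~ l) (A ^~ l) (M ^~ l.+1).
  exact: (svalP (cid (stepP l (s l)))).
have HM i l : equiv_rel (M i l) /\ bounded_rel (sval (s l)).2 (M i l).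
  exact: svalP (s l) i.
have Mmon i k l x y : (k <= l)%N -> M i k x y -> M i l x y.
  elim: l => [|l IH]; first by rewrite leqn0 => /eqP ->.
  rewrite leq_eqVlt => /predU1P[->//|]; rewrite ltnS => /IH h /h.
  by have [_ /(_ i)[h' _ _] _] := HA l; exact: h'.
have AM i k x y z : mdist x y <= k%:R -> A i k y z -> M i k.+1 x z.
  by have [_ /(_ i)[_ _ h] _] := HA k; exact: h.
have Msat i l x y z : M i l x y -> A i l y z -> A i l x z.
  by have [_ /(_ i)[_ h _] _] := HA l; exact: h.
exists A, (fun l => (sval (s l)).2); split.
- by move=> i k; have [h _ _] := HA k; exact: h.
- move=> i k l x y z kl yy xy; apply: Msat; apply: (Mmon _ _ _ _ _ kl).
  exact: AM xy yy.
- move=> i k l x y z kl xy; apply: Msat; apply: (Mmon _ _ _ _ _ kl).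
  by apply: AM xy; rewrite mdistxx.
- move=> i k K x y kK xy; have [_ Mb] := HM i K; apply: Mb.
  by apply: (Mmon _ _ _ _ _ kK); apply: AM xy; rewrite mdistxx.
- by move=> k; have [_ _ h] := HA k; exact: h.
Qed.

End BoundedFamilies.

(** * Trees and distances in their realization *)

Section TreeOfParents.
Variables (V : choiceType) (level : V -> nat) (parent : V -> V -> Prop).
Hypothesis parent_lt : forall u v, parent u v -> (level u < level v)%N.
Hypothesis parent_uniq : forall u v v', parent u v -> parent u v' -> v = v'.

Definition parent_adj : rel V := fun u v => `[< parent u v \/ parent v u >].

Lemma parent_adj_sym : symmetric parent_adj.
Proof. by move=> u v; apply/asboolP/asboolP => -[]; [right|left|right|left]. Qed.

Lemma parent_adj_irr : irreflexive parent_adj.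
Proof. by move=> u; apply/asboolP => -[] /parent_lt; rewrite ltnn. Qed.

(* Both neighbours on a cycle of a vertex of least level are its parent. *)
Lemma parent_adj_acyclic c : ucycle parent_adj c -> (size c <= 2)%N.
Proof.
case: c => // x0 c0; set c := x0 :: c0 => cc.
have [u uc umin] : exists2 u, u \in c & forall v, v \in c -> (level u <= level v)%N.
  rewrite {cc}/c; elim: c0 x0 => [|y s IH] x.
    by exists x; rewrite ?mem_head// => v; rewrite inE => /eqP ->.
  have [u us umin] := IH y; case: (leqP (level x) (level u)) => xu.
    exists x; rewrite ?mem_head// => v; rewrite inE => /predU1P[->//|vs].
    exact: leq_trans xu (umin v vs).
  exists u; first by rewrite inE us orbT.
  by move=> v; rewrite inE => /predU1P[->|/umin//]; exact: ltnW.
have [i s def_c] := rot_to uc.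
move: cc; rewrite -(rot_ucycle i parent_adj) -(size_rot i c) def_c.
have {}umin v : v \in u :: s -> (level u <= level v)%N.
  by rewrite -def_c mem_rot; exact: umin.
have up v : v \in u :: s -> parent_adj u v -> parent u v.
  move=> vs /asboolP[//|/parent_lt]; rewrite ltnNge.
  by rewrite umin.
case: s umin up {def_c} => [|y [|z s]]//= umin up; rewrite /ucycle /=.
set t := last z s.
rewrite rcons_path => /andP[/andP[uy /andP[_ /andP[_ tu]]] /and3P[_ yzs _]].
have tzs : t \in z :: s by exact: mem_last.
have ut : parent u t.
  by apply: up; [rewrite 2!inE tzs !orbT|rewrite parent_adj_sym].
have uy' : parent u y by apply: up; rewrite // inE mem_head orbT.
by rewrite (parent_uniq uy' ut) tzs in yzs.
Qed.

End TreeOfParents.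

Section Walks.
Variables (V : eqType) (e : rel V).

Definition walk u v m : Prop :=
  exists p, [/\ path e u p, last u p = v & (size p <= m)%N].

Lemma walk_refl u m : walk u u m.
Proof. by exists [::]. Qed.

Lemma walk_edge u v m : e u v -> walk u v m.+1.
Proof. by move=> uv; exists [:: v]; rewrite /= uv. Qed.

Lemma walk_trans v u w m m' : walk u v m -> walk v w m' -> walk u w (m + m').
Proof.
move=> [p [up pv pm]] [q [vq qw qm]]; exists (p ++ q).
by rewrite cat_path last_cat size_cat pv up vq leq_add.
Qed.

Lemma walk_sym u v m : symmetric e -> walk u v m -> walk v u m.
Proof.
move=> es [p [up pv pm]].
suff h : walk v u (size p).
  by have [q [? ? qp]] := h; exists q; split => //; exact: leq_trans qp pm.
elim: p u up pv {pm} => [|w p IH] u /=; first by move=> _ ->; exact: walk_refl.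
move=> /andP[uw wp] pv; rewrite -addn1; apply: walk_trans (IH _ wp pv) _.
by apply: walk_edge; rewrite es.
Qed.

End Walks.

Section RealizationDistance.
Variables (R : realType) (T : tree).
Implicit Types (u v : vertex T) (s t : R).

Lemma tree_point_vertex u : tree_point (edge_point u u (0 : R)).
Proof. by exists u, u, 0; split; [left|rewrite lexx ler01|]. Qed.

Definition vertex_point u : tree_space R T := TreeSpace (asboolT (tree_point_vertex u)).

Lemma polyline_walk u v m : walk (@adj T) u v m ->
  exists2 l : R, polyline (edge_point u u 0) (edge_point v v 0) l & l <= m%:R.
Proof.
move=> [p [up pv pm]].
suff h : polyline (edge_point u u 0) (edge_point v v 0) ((size p)%:R : R).
  by exists (size p)%:R => //; rewrite ler_nat.
elim: p u up pv {pm} => [|w p IH] u /=; first by move=> _ ->; exact: polyline_nil.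
move=> /andP[uw wp] pv.
have -> : (size p).+1%:R = `|0 - 1 : R| + (size p)%:R.
  by rewrite sub0r normrN normr1 addrC natr1.
rewrite -(edge_point0 R u w); apply: polyline_cons; rewrite ?lexx ?ler01//.
by rewrite edge_point1; exact: IH.
Qed.

Lemma tree_dist_walk u v m : walk (@adj T) u v m ->
  tree_dist (vertex_point u) (vertex_point v) <= m%:R.
Proof. by move=> /polyline_walk[l h lm]; apply: le_trans lm; exact: tree_dist_le. Qed.

Section Lipschitz.
Variable g : vertex T -> R.
Hypothesis g_lip : forall u v, adj u v -> `|g u - g v| <= 1.

(* The affine extension of [g] to the edge uv. *)
Let ext u v s := (1 - s) * g u + s * g v.

Let extE u v s (S : seq (vertex T)) : uniq S -> u \in S -> v \in S ->
  ext u v s = \sum_(w <- S) edge_point u v s w * g w.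
Proof.
move=> Su uS vS.
have sum1 z : z \in S -> \sum_(w <- S) (w == z)%:R * g w = g z.
  move=> zS; rewrite (bigD1_seq z)//= eqxx mul1r big1 ?addr0// => w /negPf ->.
  by rewrite mul0r.
rewrite /ext -(sum1 u)// -(sum1 v)// !mulr_sumr -big_split/=.
by apply: eq_bigr => w _; rewrite /edge_point; lra.
Qed.

Let ext_eq u v s u' v' s' :
  edge_point u v s = edge_point u' v' s' -> ext u v s = ext u' v' s'.
Proof.
move=> h; pose S := undup [:: u; v; u'; v'].
by rewrite !(@extE _ _ _ S) ?undup_uniq ?mem_undup ?inE ?eqxx ?orbT// h.
Qed.

Lemma polyline_lipschitz x y l : polyline x y l ->
  forall u v s u' v' t, x = edge_point u v s -> y = edge_point u' v' t ->
  `|ext u v s - ext u' v' t| <= l.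
Proof.
elim=> [{}x|u0 v0 s0 t0 {}y {}l uv s01 t01 _ IH] u v s u' v' t.
  by move=> -> /ext_eq ->; rewrite subrr normr0.
move=> /ext_eq <- yE; apply: le_trans (ler_distD (ext u0 v0 t0) _ _) _.
apply: lerD; last exact: IH.
have -> : ext u0 v0 s0 - ext u0 v0 t0 = - (s0 - t0) * (g u0 - g v0).
  by rewrite /ext; lra.
by rewrite normrM normrN ler_piMr// g_lip.
Qed.

Lemma tree_dist_lipschitz u v :
  `|g u - g v| <= tree_dist (vertex_point u) (vertex_point v).
Proof.
apply: le_tree_dist => l /polyline_lipschitz/(_ u u 0 v v 0 erefl erefl).
by rewrite /ext !subr0 !mul1r !mul0r !addr0.
Qed.

End Lipschitz.

End RealizationDistance.

Lemma proper_totally_bounded (R : realType) (X : metricType R) (x : X) (r e : R) :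
  proper_space X -> 0 < e ->
  exists2 Z : set X, finite_set Z &
    forall y, mdist x y <= r -> exists2 z, Z z & mdist z y < e.
Proof.
move=> Xp e0; pose K := closure [set y | mdist x y <= r].
have cK : compact K.
  apply: Xp; last exact: closed_closure.
  apply: (@le_lt_trans _ _ (2 * (r + 1))%:E); last by rewrite ltry.
  have Kr y : K y -> mdist x y <= r + 1.
    move=> /(_ _ (nbhsx_ballx y 1 ltr01))[z []]/=; rewrite ballEmdist/=.
    by have := metric_triangle x z y; rewrite (metric_sym y z); lra.
  apply: ge_ereal_sup => _ [[y z]/= [/Kr xy /Kr xz] <-]; rewrite lee_fin.
  by have := metric_triangle y x z; rewrite (metric_sym y x); lra.
pose F : set_system (set X) := [set Q | exists2 Z : set X, finite_set Z &
  forall Z', finite_set Z' -> Z `<=` Z' -> Q Z'].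
have FF : Filter F.
  split.
  - by exists set0.
  - move=> P Q [Z fZ ZP] [Z' fZ' Z'Q]; exists (Z `|` Z').
      by rewrite finite_setU.
    move=> W fW; rewrite subUset => -[ZW Z'W].
    by split; [exact: ZP|exact: Z'Q].
  - by move=> P Q PQ [Z fZ ZP]; exists Z => // W fW /(ZP W fW)/PQ.
have /compact_near_coveringP := cK.
move=> /(_ _ F (fun Z y => exists2 z, Z z & mdist z y < e) FF)[].
  move=> y Ky; exists (ball y e, [set Z : set X | Z y]); first split => /=.
  - exact: nbhsx_ballx.
  - by exists [set y] => // Z' _; apply; exact: erefl.
  - by move=> [z Z]/= [yz Zy]; exists y => //; rewrite ballEmdist in yz.
move=> Z fZ /(_ Z fZ (@subset_refl _ Z)) h; exists Z => // y xy.
by apply: h; exact: subset_closure.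
Qed.

Lemma sum_nat_sparse (b : pred nat) K l :
  (forall k k', (K <= k < k')%N -> (k' < l)%N -> b k -> b k' -> False) ->
  (\sum_(k < l) b k <= K.+1)%N.
Proof.
have sum_le m : (\sum_(k < m) b k <= m)%N.
  rewrite -[leqRHS]card_ord -sum1_card; apply: leq_sum => k _.
  exact: leq_b1.
have none m : (forall k, (K <= k < m)%N -> ~~ b k) -> (\sum_(k < m) b k <= K)%N.
  elim: m => [|m IH] h; first by rewrite big_ord0.
  case: (ltnP m K) => mK; first exact: leq_trans (sum_le _) mK.
  rewrite big_ord_recr/= (negPf (h m _)) ?addn0 ?mK ?ltnSn//.
  by apply: IH => k /andP[Kk km]; apply: h; rewrite Kk ltnW.
elim: l => [|l IH] h; first by rewrite big_ord0.
rewrite big_ord_recr/=; case bl: (b l); last first.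
  by rewrite addn0; apply: IH => k k' kk' k'l; apply: h => //; exact: ltnW.
rewrite addn1 ltnS; apply: none => k /andP[Kk kl]; apply/negP => bk.
by apply: (h k l) => //; rewrite Kk.
Qed.

(** * The tree of a nested family *)

Section NestedFamilyTree.
Variables (R : realType) (X : metricType R) (x0 : X) (A : nat -> X -> X -> Prop).
Hypothesis A_per : forall k, per (A k).
Hypothesis A_nest : forall k l x y z, (k < l)%N -> A k x y -> A l y z -> A l x z.
Hypothesis A_ball : forall k x y,
  mdist x0 x <= k%:R -> mdist x0 y <= k%:R -> A k x y.

Let A_sym k x y : A k x y -> A k y x.
Proof. by have [h _] := A_per k; exact: h. Qed.

Let A_trans k x y z : A k x y -> A k y z -> A k x z.
Proof. by have [_ h] := A_per k; exact: h. Qed.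

Let A_refl k x y : A k x y -> A k x x.
Proof. exact: per_refl. Qed.

Let A_eq k x y : A k x y -> A k x = A k y.
Proof.
move=> xy; apply/funext => z; apply/propext; split; last exact: A_trans.
exact/A_trans/A_sym.
Qed.

Let A_ex x y m : exists2 k, (m <= k)%N & A k x y.
Proof.
pose t := Num.max m%:R (Num.max (mdist x0 x) (mdist x0 y)).
have t0 : 0 <= t by rewrite le_max ler0n.
have := truncnS_gt t; rewrite !gt_max ltr_nat => /and3P[mk xk yk].
by exists (Num.truncn t).+1; [exact: ltnW|apply: A_ball; exact: ltW].
Qed.

Let upper_level x m : exists k, (m <= k)%N && `[< A k x x >].
Proof. by have [k mk /asboolP xx] := A_ex x x m; exists k; rewrite mk. Qed.

Definition next_set_level x m : nat := ex_minn (upper_level x m).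

Local Notation up := next_set_level.

Let up_ge x m : (m <= up x m)%N.
Proof. by rewrite /up; case: ex_minnP => k /andP[]. Qed.

Let upP x m : A (up x m) x x.
Proof. by rewrite /up; case: ex_minnP => k /andP[_ /asboolP]. Qed.

Let up_min x m k : (m <= k)%N -> A k x x -> (up x m <= k)%N.
Proof.
move=> mk xx; rewrite /up; case: ex_minnP => j _; apply.
by rewrite mk; exact/asboolP.
Qed.

Let up_id x m : A m x x -> up x m = m.
Proof. by move=> xx; apply/eqP; rewrite eqn_leq up_ge up_min. Qed.

Let up_skip x m : ~ A m x x -> up x m = up x m.+1.
Proof.
move=> xx; apply/eqP; rewrite eqn_leq !up_min//.
- rewrite ltn_neqAle up_ge andbT; apply/eqP => mE; apply: xx; rewrite mE.
  exact: upP.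
- exact: ltnW (up_ge x m.+1).
Qed.

Definition family_vertex : Type :=
  {p : nat * set X | `[< exists2 x, A p.1 x x & p.2 = A p.1 x >]}.

HB.instance Definition _ := Choice.on family_vertex.

Implicit Types u v : family_vertex.

Let up_vertexP x m :
  `[< exists2 y, A (up x m) y y & A (up x m) x = A (up x m) y >].
Proof. by apply/asboolP; exists x => //; exact: upP. Qed.

Definition up_vertex x m : family_vertex :=
  exist _ (up x m, A (up x m) x) (up_vertexP x m).

Local Notation w := up_vertex.

Let vertexP u : exists x m, A m x x /\ u = w x m.
Proof.
case: u => -[k c] /[dup] /asboolP[/= x xx cx] p; exists x, k; split => //.
by apply: val_inj => /=; rewrite up_id// cx.
Qed.

Let w_eq k m x y : (k <= m)%N -> A k x y -> w x m = w y m.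
Proof.
move=> km xy; apply: val_inj => /=.
have step a b : A k a b -> (up b m <= up a m)%N /\
   A (up a m) a b.
  move=> ab; have : A (up a m) b a.
    have kup := leq_trans km (up_ge a m).
    move: kup; rewrite leq_eqVlt => /predU1P[<-|kup]; first exact: A_sym.
    exact: A_nest kup (A_sym ab) (upP a m).
  by move=> ba; split; [exact: up_min (up_ge a m) (A_refl ba)|exact: A_sym].
have [h1 h] := step _ _ xy; have [h2 _] := step _ _ (A_sym xy).
have -> : up y m = up x m by apply/eqP; rewrite eqn_leq h1 h2.
by rewrite (A_eq h).
Qed.

Definition family_parent u v : Prop :=
  exists x m, [/\ A m x x, u = w x m & v = w x m.+1].

Definition vertex_level u : nat := (val u).1.

Let w_inj x y m m' : A m x x -> A m' y y -> w x m = w y m' -> m = m' /\ A m x y.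
Proof.
move=> xx yy /(congr1 val)/=; rewrite !up_id// => -[mm' AE]; split => //.
by rewrite AE.
Qed.

Lemma family_parent_lt u v : family_parent u v -> (vertex_level u < vertex_level v)%N.
Proof.
by move=> [x [m [xx -> ->]]]; rewrite /vertex_level/= up_id// up_ge.
Qed.

Lemma family_parent_uniq u v v' :
  family_parent u v -> family_parent u v' -> v = v'.
Proof.
move=> [x [m [xx -> ->]]] [y [m' [yy /(w_inj xx yy) [<- xy] ->]]].
exact: w_eq xy.
Qed.

Definition count_sets x l : nat := \sum_(k < l) `[< A k x x >].

Lemma walk_up x l : walk (parent_adj family_parent) (w x 0) (w x l) (count_sets x l).
Proof.
rewrite /count_sets; elim: l => [|l IH]; first by rewrite big_ord0; exact: walk_refl.
rewrite big_ord_recr/=; apply: walk_trans IH _.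
case: asboolP => xx.
  by apply: walk_edge; apply/asboolP; left; exists x, l.
have -> : w x l.+1 = w x l; last exact: walk_refl.
by apply: val_inj => /=; rewrite (up_skip xx).
Qed.

Lemma walk_common x y l : A l x y ->
  walk (parent_adj family_parent) (w x 0) (w y 0) (count_sets x l + count_sets y l).
Proof.
move=> xy; apply: walk_trans (walk_up x l) _; rewrite (w_eq (leqnn l) xy).
exact: walk_sym (@parent_adj_sym _ _) (walk_up y l).
Qed.

Lemma family_connected u v :
  exists2 p, path (parent_adj family_parent) u p & last u p = v.
Proof.
have [x [m [xx ->]]] := vertexP u; have [y [m' [yy ->]]] := vertexP v.
have [l _ xy] := A_ex x y 0.
have wx z i : exists n, walk (parent_adj family_parent) (w z 0) (w z i) n.
  by exists (count_sets z i); exact: walk_up.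
have [a xa] := wx x m; have [b yb] := wx y m'.
have [p [? ? _]] := walk_trans (walk_trans
  (walk_sym (@parent_adj_sym _ _) xa) (walk_common xy)) yb.
by exists p.
Qed.

Definition family_tree : tree :=
  Tree (@parent_adj_sym _ family_parent)
    (parent_adj_irr family_parent_lt) (inhabits (w x0 0))
    family_connected (parent_adj_acyclic family_parent_lt family_parent_uniq).

Definition family_map x : tree_space R family_tree :=
  @vertex_point R family_tree (w x 0).

Lemma family_map_le l x y : A l x y ->
  mdist (family_map x) (family_map y) <= (count_sets x l + count_sets y l)%:R.
Proof. by move=> xy; apply: tree_dist_walk; exact: walk_common. Qed.

Section Upper.
Hypothesis A_thick : forall k l x y z, (k < l)%N ->
  A k y y -> mdist x y <= k%:R -> A l y z -> A l x z.

Lemma family_map_upper K x y : mdist x y <= K%:R ->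
  mdist (family_map x) (family_map y) <= (K.+1 + K.+1)%:R.
Proof.
move=> xyK; have ex : exists l, `[< A l x y >].
  by have [l _ xy] := A_ex x y 0; exists l; apply/asboolP.
case: (ex_minnP ex) => l /asboolP xy lmin.
apply: le_trans (family_map_le xy) _; rewrite ler_nat.
have main a b : mdist a b <= K%:R -> (forall k, A k a b -> (l <= k)%N) ->
    (count_sets a l <= K.+1)%N.
  move=> ab amin; apply: (@sum_nat_sparse (fun k => `[< A k a a >])) => k k' /andP[Kk kk'] k'l.
  move=> /asboolP ka /asboolP k'a; move: k'l; rewrite ltnNge amin//.
  apply: A_sym; apply: (A_thick kk' ka _ k'a).
  by rewrite metric_sym (le_trans ab)// ler_nat.
apply: leq_add; first by apply: main xyK _ => k /asboolP; exact: lmin.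
apply: (main y x); first by rewrite metric_sym.
by move=> k /A_sym/asboolP; exact: lmin.
Qed.

End Upper.

Section Lower.
Variables (x : X) (K : nat).

Let below k u : bool :=
  `[< (vertex_level u <= k)%N /\ forall z, (val u).2 z -> A k x z >].

Let belowE k y m : A m y y -> below k (w y m) = `[< (m <= k)%N /\ A k x y >].
Proof.
move=> yy; rewrite /below /vertex_level/= up_id//.
apply/asboolP/asboolP => -[mk h]; split => //; first exact: h.
move=> z yz; move: mk; rewrite leq_eqVlt => /predU1P[mk|mk].
  by apply: A_trans h _; rewrite -mk.
exact/A_sym/(A_nest mk (A_sym yz))/A_sym.
Qed.

Let w_up y m : w y m = w y (up y m).
Proof. by apply: val_inj => /=; rewrite (up_id (upP y m)). Qed.

Let depth u : nat := \sum_(k < K) below k u.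

Let depth_parent u v : family_parent u v -> (depth v <= depth u <= depth v + 1)%N.
Proof.
move=> [y [m [yy -> ->]]]; have jm := up_ge y m.+1.
rewrite [w y m.+1]w_up /depth; apply/andP; split.
  apply: leq_sum => k _; rewrite (belowE _ yy) (belowE _ (upP y m.+1)).
  by case: asboolP => // -[jk xy]; rewrite asboolT//; split => //; lia.
have m1 : (\sum_(k < K) pred1 m k <= 1)%N.
  by apply: (@sum_nat_sparse (pred1 m) 0) => k k' /andP[_ kk'] _ /eqP km /eqP km'; lia.
apply: leq_trans (leq_add (leqnn _) m1); rewrite -big_split/=.
apply: leq_sum => k _; rewrite (belowE _ yy) (belowE _ (upP y m.+1)).
case: asboolP => // -[]; rewrite leq_eqVlt => /predU1P[<-|mk xy].
  by rewrite eqxx addn1.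
by rewrite asboolT//; split => //; exact: up_min mk (A_refl (A_sym xy)).
Qed.

Let depth_lipschitz u v : parent_adj family_parent u v ->
  `|(depth u)%:R - (depth v)%:R| <= 1 :> R.
Proof.
move=> /asboolP uv.
have main a b : family_parent a b -> `|(depth a)%:R - (depth b)%:R| <= 1 :> R.
  move=> /depth_parent/andP[ba ab]; rewrite ger0_norm ?subr_ge0 ?ler_nat//.
  by rewrite lerBlDr nat1r ler_nat -addn1.
by case: uv => [/main//|/main]; rewrite distrC.
Qed.

Lemma family_map_lower y : (forall k, (k < K)%N -> ~ A k x y) ->
  (count_sets x K)%:R <= mdist (family_map x) (family_map y).
Proof.
move=> nxy.
have := @tree_dist_lipschitz R family_tree (fun u => (depth u)%:R)
  depth_lipschitz (w x 0) (w y 0).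
have -> : depth (w y 0) = 0%N.
  rewrite w_up /depth big1// => k _; rewrite (belowE _ (upP y 0)).
  by case: asboolP => // -[_ xy]; case: (nxy k).
have -> : depth (w x 0) = count_sets x K.
  rewrite w_up /depth; apply: eq_bigr => k _; rewrite (belowE _ (upP x 0)).
  congr nat_of_bool; apply/asboolP/asboolP => [[]//|xx]; split => //.
  exact: up_min.
by rewrite subr0 ger0_norm ?ler0n.
Qed.

End Lower.

Section LocallyFinite.
Hypothesis A_sep : forall k : nat, separated_rel 1 (A k).
Hypothesis A_bnd : forall k, exists D : R, bounded_rel D (A k).
Hypothesis X_proper : proper_space X.

Lemma family_tree_locally_finite : locally_finite_tree family_tree.
Proof.
move=> u /=; have [x [k [xx uE]]] := vertexP u.
have [D AD] := A_bnd k.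
have half0 : 0 < 2^-1 :> R by rewrite invr_gt0 ltr0n.
have [Z fZ HZ] := proper_totally_bounded x D X_proper half0.
pose child z m := w (xget z [set y | A m y y /\ mdist z y < 2^-1]) m.
pose C := \bigcup_(m in `I_k) [set child z m | z in Z].
apply: (@sub_finite_set _ _ (C `|` [set w x k.+1])); last first.
  rewrite finite_setU; split; last exact: finite_set1.
  by apply: bigcup_finite; [exact: finite_II|move=> m _; exact: finite_image].
move=> v /asboolP[uv|[y [m [yy -> uE']]]]; [right|left].
  by apply: (family_parent_uniq uv); exists x, k.
have mk : (m < k)%N.
  have := congr1 vertex_level uE'; rewrite uE /vertex_level/= up_id// => ->.
  exact: up_ge.
have kxy : A k x y.
  have := congr1 (fun a : family_vertex => (val a).2 y) uE'; rewrite uE /= => h.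
  by rewrite -[k](up_id xx) h; exact: upP.
have [z Zz zy] := HZ y (AD _ _ kxy).
exists m => //; exists z => //; rewrite /child.
case: xgetP => [y' _ [y'y' zy']|/(_ y)]; last by case.
apply: (@w_eq m) => //; apply: A_sep => //.
have := metric_triangle y' z y; rewrite (metric_sym y' z); lra.
Qed.

End LocallyFinite.

End NestedFamilyTree.

(** * The coarse embedding *)

Lemma coarse_embedding_of_nat_bounds (R : realType) (X Y : metricType R) (F : X -> Y)
    (rho : nat -> nat) (D : nat -> R) (c : R) : 0 < c ->
  {homo rho : m n / (m <= n)%N} ->
  (forall K x y, mdist x y <= K%:R -> mdist (F x) (F y) <= (rho K)%:R) ->
  (forall K x y, D K < mdist x y -> K%:R <= c * mdist (F x) (F y)) ->
  coarse_embedding F.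
Proof.
move=> c0 rho_mono Fup Flow; split.
  exists (fun t => (rho (Num.truncn t).+1)%:R); last first.
    by move=> x y; apply: Fup; apply/ltW/truncnS_gt.
  by split=> [t _|s t _ st]; rewrite ?ler0n// ler_nat rho_mono// ltnS le_truncn.
pose m (t : R) := (\max_(K < (Num.truncn t).+1 | (D K < t)%R) K)%N.
exists (fun t => (m t)%:R / c); split.
- split=> [t _|s t _ st]; first by rewrite divr_ge0 ?ler0n// ltW.
  rewrite ler_pM2r ?invr_gt0// ler_nat; apply/bigmax_leqP => K DK.
  have Kt : (K < (Num.truncn t).+1)%N.
    by apply: leq_trans (ltn_ord K) _; rewrite ltnS le_truncn.
  apply: (@leq_bigmax_cond _ _ (fun K : 'I__ => K : nat) (Ordinal Kt)).
  exact: lt_le_trans DK st.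
- apply/cvgryPge => a; pose K := (Num.truncn (a * c)).+1.
  exists (Num.max K%:R (D K)); split; first exact: num_real.
  move=> t; rewrite gt_max => /andP[Kt DKt].
  rewrite ler_pdivlMr//; apply: le_trans (ltW (truncnS_gt _)) _.
  rewrite ler_nat -/K.
  have Kt' : (K < (Num.truncn t).+1)%N.
    by rewrite ltnS truncn_ge_nat ?ltW// (le_lt_trans _ Kt).
  exact: (@leq_bigmax_cond _ _ (fun K : 'I__ => K : nat) (Ordinal Kt')).
- move=> x y; rewrite ler_pdivrMr// [leRHS]mulrC.
  apply: (big_ind (fun k => k%:R <= c * mdist (F x) (F y))).
  + by rewrite mulr_ge0 ?mdist_ge0// ltW.
  + by move=> j k hj hk; case: (leqP j k).
  + by move=> K /Flow.
Qed.

Lemma point_tree_connected (u v : unit) :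
  exists2 p, path (fun _ _ : unit => false) u p & last u p = v.
Proof. by exists [::]; case: u v => -[]. Qed.

Lemma point_tree_acyclic c : ucycle (fun _ _ : unit => false) c -> (size c <= 2)%N.
Proof. by case: c => [|? []]. Qed.

Definition point_tree : tree :=
  @Tree unit (fun _ _ => false) (fun _ _ => erefl) (fun=> erefl) (inhabits tt)
    point_tree_connected point_tree_acyclic.

Lemma coarse_embedding_trees (R : realType) (n : nat) (X : metricType R) :
  asdim_le X n -> exists (T : 'I_n.+1 -> tree) (F : X -> tree_product R T),
    coarse_embedding F /\
    (proper_space X -> forall j, locally_finite_tree (T j)).
Proof.
move=> Xn; have [[x0 _]|X0] := pselect (exists x : X, True); last first.
  have absurd (x : X) : False by apply: X0; exists x.
  exists (fun=> point_tree), (fun x => False_rect _ (absurd x)); split.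
    by apply: (@coarse_embedding_of_nat_bounds _ _ _ _ id (fun=> 0) 1) => // ? x;
      have := absurd x.
  move=> _ j u; rewrite (_ : [set _ | _] = set0); first exact: finite_set0.
  by rewrite -subset0.
have [A [D [HA Athick Anest Abnd Acov]]] := hierarchy_ex x0 Xn.
have Aper i k : per (A i k) by have [] := HA i k.
have Aball i k x y : mdist x0 x <= k%:R -> mdist x0 y <= k%:R -> A i k x y.
  by have [_ _ h] := HA i k; exact: h.
pose T i := family_tree (Aper i) (Anest i) (Aball i).
pose F x : tree_product R T := fun i => family_map (Aper i) (Anest i) (Aball i) x.
exists T, F; split; last first.
  move=> Xp j; apply: family_tree_locally_finite => //.
    by move=> k; have [] := HA j k.
  by move=> k; exists (D k.+1) => x y; exact: Abnd.
apply: (@coarse_embedding_of_nat_bounds _ _ _ _ (fun K => (K.+1 + K.+1)%N) D n.+1%:R).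
- by rewrite ltr0n.
- by move=> k l kl; rewrite leq_add.
- move=> K x y xyK; apply: bigmax_le => [|j _]; first by rewrite ler0n.
  exact: family_map_upper (Athick j) _ _ _ xyK.
- move=> K x y DKxy.
  have : (K <= \sum_(i < n.+1) count_sets (A i) x K)%N.
    rewrite exchange_big/= -[leqLHS]card_ord -sum1_card; apply: leq_sum => k _.
    have [i xi] := Acov k x.
    by rewrite (bigD1 i)//= asboolT.
  rewrite -(ler_nat R) => /le_trans; apply; rewrite natr_sum.
  rewrite -[n.+1 in leRHS]card_ord -sum1_card natr_sum mulr_suml.
  apply: ler_sum => i _; rewrite mul1r.
  apply: le_trans (le_sup_dist i (F x) (F y)); apply: family_map_lower => k kK xy.
  by move: DKxy; rewrite ltNge (Abnd i k).
Qed.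

Theorem theorem1 (R : realType) (n : nat) (X : metricType R)
    (asdimX : asdim_le X n) :
  (exists (T : 'I_n.+1 -> tree) (F : X -> tree_product R T),
      coarse_embedding F) /\
  (proper_space X ->
   exists (T : 'I_n.+1 -> tree) (F : X -> tree_product R T),
      (forall j, locally_finite_tree (T j)) /\ coarse_embedding F).
Proof.
have [T [F [Femb Tfin]]] := coarse_embedding_trees asdimX.
by split=> [|/Tfin ?]; exists T, F.
Qed.
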